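(* Consider a two-qubit system ($d_A=d_B=2$), with the local operator bases on both sides chosen as the Pauli basis $F_i=\sigma_i/\sqrt2$, $i=1,2,3$. Then for any state $\rho$ on $\mathbb{C}^2\otimes\mathbb{C}^2$, $$\mathcal{E}(\rho)\ge\frac13\Bigl(\|R\|_{\mathrm{Tr}}-\frac12\Bigr),$$ where $R=(R_{ij})$ with $R_{ij}=\frac12\operatorname{Tr}[\rho(\sigma_i\otimes\sigma_j)]$ is the correlation matrix and $\|R\|_{\mathrm{Tr}}=\operatorname{Tr}(\sqrt{R^\dagger R})$.
   Context: $\sigma_1,\sigma_2,\sigma_3$ are the Pauli matrices. Let $\mathcal{H}_A=\mathcal{H}_B=\mathbb{C}^2$, $\mathcal{H}_{AB}=\mathcal{H}_A\otimes\mathcal{H}_B$. Write $\mathcal{D}(\mathcal{H})$ for the density operators on $\mathcal{H}$ and $\mathcal{SEP}(\mathcal{H}_{AB})$ for the set of separable states (convex combinations of product states $\sigma_A\otimes\sigma_B$). Let $\mathcal{K}_0=\{F_i\otimes I_B\}_{i=1}^3\cup\{I_A\otimes F_j\}_{j=1}^3$ with $F_i=\sigma_i/\sqrt2$. On two copies $\mathcal{H}_{AB}^{(1)}\otimes\mathcal{H}_{AB}^{(2)}$ of $\mathcal{H}_{AB}$ define the cost operator $$C=\sum_{X\in\mathcal{K}_0}\bigl(X\otimes I_{AB}^{(2)}-I_{AB}^{(1)}\otimes X\bigr)^2 .$$ For $\rho,\sigma\in\mathcal{D}(\mathcal{H}_{AB})$ let $\Pi(\rho,\sigma)$ be the set of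 density operators on $\mathcal{H}_{AB}^{(1)}\otimes\mathcal{H}_{AB}^{(2)}$ with marginals $\rho$ and $\sigma$. The quantum Wasserstein distance of order 1 is $W_1(\rho,\sigma)=\bigl(\inf_{\tau\in\Pi(\rho,\sigma)}\operatorname{Tr}[C\tau]\bigr)^{1/2}$, and the Wasserstein entanglement measure is $$\mathcal{E}(\rho)=\inf_{\sigma\in\mathcal{SEP}(\mathcal{H}_{AB})}W_1(\rho,\sigma).$$ *)

(* Defs.v *)
From HB Require Import structures.
From mathcomp Require Export all_boot all_order all_algebra.
From mathcomp Require Export classical_sets reals.
From mathcomp Require Export complex mxtens.
Set Implicit Arguments.
Unset Strict Implicit.
Unset Printing Implicit Defensive.

Import Order.TTheory GRing.Theory Num.Theory.
Local Open Scope classical_set_scope.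
Local Open Scope ring_scope.
Local Open Scope sesquilinear_scope.

(* The order of R[i] is partial: 0 <= z says that z is real and nonnegative. *)
Definition psdmx (C : numClosedFieldType) (n : nat) (A : 'M[C]_n) : Prop :=
  A \is hermsymmx /\ forall v : 'cV[C]_n, 0 <= (v^t* *m A *m v) 0 0.

(* Square root by the functional calculus on a unitary diagonalization; it is
   the positive square root of A when A is positive semidefinite (sqrtmx_psd,
   sqrtmxK), and only used in that case. *)
Definition sqrtmx (C : numClosedFieldType) (n : nat) (A : 'M[C]_n) : 'M[C]_n :=
  invmx (spectralmx A) *m diag_mx (map_mx sqrtC (spectral_diag A))
    *m spectralmx A.

Section SquareRoot.
Variables (C : numClosedFieldType) (n : nat).
Implicit Type A : 'M[C]_n.

Lemma psd_spectral_diag_ge0 A (j : 'I_n) :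
  psdmx A -> 0 <= spectral_diag A 0 j.
Proof.
move=> [Aherm Apos].
have /orthomx_spectralP AE := hermitian_normalmx Aherm.
have := Apos ((spectralmx A)^t* *m delta_mx j 0).
set P := spectralmx A in AE *; set d := spectral_diag A in AE *.
have Pu : P \is unitarymx by exact: spectral_unitarymx.
have PP : P *m P^t* = 1%:M by apply/unitarymxP.
rewrite AE invmx_unitary // trmx_mul map_mxM trmxCK.
rewrite -!mulmxA [P *m (P^t* *m _)]mulmxA PP mul1mx [P *m (P^t* *m _)]mulmxA PP mul1mx.
rewrite mul_diag_mx !mxE (bigD1 j) //= big1 => [|i /negPf ij].
  by rewrite !mxE !eqxx conjC1 mul1r mulr1 addr0.
by rewrite !mxE ij mulr0 mulr0.
Qed.

Lemma sqrtmxK A : psdmx A -> sqrtmx A *m sqrtmx A = A.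
Proof.
move=> [Aherm _]; have /orthomx_spectralP AE := hermitian_normalmx Aherm.
rewrite [RHS]AE /sqrtmx -!mulmxA; congr (_ *m _).
rewrite [spectralmx A *m (invmx _ *m _)]mulmxA mulmxV ?spectral_unit // mul1mx.
rewrite mulmxA mulmx_diag; congr (diag_mx _ *m _).
by apply/rowP => j; rewrite !mxE -expr2 sqrtCK.
Qed.

Lemma sqrtmx_psd A : psdmx A -> psdmx (sqrtmx A).
Proof.
move=> Apsd; rewrite /sqrtmx invmx_unitary ?spectral_unitarymx //.
set P := spectralmx A; set s := map_mx sqrtC _.
have s_ge0 j : 0 <= s 0 j by rewrite mxE sqrtC_ge0 psd_spectral_diag_ge0.
split.
  rewrite qualifE /= expr0 scale1r !trmx_mul !map_mxM trmxCK mulmxA.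
  apply/eqP; congr (_ *m _ *m _); apply/matrixP => i j; rewrite !mxE eq_sym.
  case: eqVneq => [->|_]; last by rewrite !mulr0n rmorph0.
  by rewrite !mulr1n; apply/esym/geC0_conj; have := s_ge0 i; rewrite mxE.
move=> v; set w := P *m v.
have -> : v^t* *m (P^t* *m diag_mx s *m P) *m v = w^t* *m (diag_mx s *m w).
  by rewrite trmx_mul map_mxM -!mulmxA.
rewrite mul_diag_mx !mxE; apply: sumr_ge0 => i _.
rewrite [X in X * _]mxE [X in _ * X]mxE mulrCA mulr_ge0 ?s_ge0 //.
by rewrite mxE mulrC mul_conjC_ge0.
Qed.

End SquareRoot.

Section QuantumWasserstein.
Variable R : realType.
Local Notation C := R[i].
Local Notation qubits := (2 * 2)%N.

(* Traces of products of Hermitian matrices, as well as trace norms, are real;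
   Re only changes the type from R[i] to R. *)
Definition trace_norm (m n : nat) (A : 'M[C]_(m, n)) : R :=
  complex.Re (\tr (sqrtmx (A^t* *m A))).

Definition density (n : nat) (rho : 'M[C]_n) : Prop :=
  psdmx rho /\ \tr rho = 1.

Definition separable (m n : nat) : set 'M[C]_(m * n) :=
  [set sigma | exists (k : nat) (p : 'I_k -> R)
     (a : 'I_k -> 'M[C]_m) (b : 'I_k -> 'M[C]_n),
     [/\ forall i, 0 <= p i, \sum_i p i = 1,
         forall i, density (a i), forall i, density (b i)
       & sigma = \sum_i (p i)%:C%C *: (a i *t b i)]].

(* Partial traces over the second, resp. first, tensor factor. *)
Definition marginal1 (m n : nat) (tau : 'M[C]_(m * n)) : 'M[C]_m :=
  \matrix_(i, j) \sum_(k < n) tau (mxtens_index (i, k)) (mxtens_index (j, k)).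

Definition marginal2 (m n : nat) (tau : 'M[C]_(m * n)) : 'M[C]_n :=
  \matrix_(i, j) \sum_(k < m) tau (mxtens_index (k, i)) (mxtens_index (k, j)).

Definition couplings (m n : nat) (rho : 'M[C]_m) (sigma : 'M[C]_n) :
    set 'M[C]_(m * n) :=
  [set tau | [/\ density tau, marginal1 tau = rho & marginal2 tau = sigma]].

Definition mx22 (a b c d : C) : 'M[C]_2 :=
  \matrix_(i, j) if i == 0 then (if j == 0 then a else b)
                 else (if j == 0 then c else d).

(* Indices are shifted: pauli 0, pauli 1, pauli 2 are sigma_1, sigma_2, sigma_3. *)
Definition pauli (k : 'I_3) : 'M[C]_2 :=
  match val k with
  | 0%N => mx22 0 1 1 0
  | 1%N => mx22 0 (- 'i%C) 'i%C 0
  | _ => mx22 1 0 0 (- 1)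
  end.

Definition pauli_basis (k : 'I_3) : 'M[C]_2 := (Num.sqrt 2)^-1%:C%C *: pauli k.

(* The six operators F_i (x) I_B and I_A (x) F_j, as a family. *)
Definition local_ops (x : 'I_3 + 'I_3) : 'M[C]_qubits :=
  match x with
  | inl i => pauli_basis i *t 1%:M
  | inr j => 1%:M *t pauli_basis j
  end.

Definition cost : 'M[C]_(qubits * qubits) :=
  \sum_(x : 'I_3 + 'I_3)
    (local_ops x *t (1%:M : 'M_qubits) - (1%:M : 'M_qubits) *t local_ops x) ^+ 2.

(* inf is 0 by convention on sets that are empty or unbounded below. Neither
   happens in W1 and wasserstein_ent for density operators: rho (x) sigma is a
   coupling, product states are separable, and cost is positive semidefinite. *)
Definition W1 (rho sigma : 'M[C]_qubits) : R :=
  Num.sqrt (inf [set complex.Re (\tr (cost *m tau)) | tau in couplings rho sigma]).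

Definition wasserstein_ent (rho : 'M[C]_qubits) : R :=
  inf [set W1 rho sigma | sigma in separable (m := 2) (n := 2)].

Definition corr_mx (rho : 'M[C]_qubits) : 'M[C]_3 :=
  \matrix_(i, j) (2^-1 * \tr (rho *m (pauli i *t pauli j))).

End QuantumWasserstein.

(* Main.v *)
(* By polar decomposition, ||R|| = Tr(O^* R) for a partial isometry O, so it
   suffices to bound Re Tr(O^* (R_rho - R_sigma)) and Re Tr(O^* R_sigma). The
   latter is at most 1/2 for separable sigma, because Bloch vectors have squared
   norm at most 1/2 in this normalization. For the former, let tau be a coupling
   and D_X = X (x) I - I (x) X. For commuting A and B,
     AB (x) I - I (x) AB = D_A (B (x) I) + D_B (I (x) A),
   and Cauchy-Schwarz for Tr[tau .], in its quadratic form with a free parameter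
   s, applied to each of the 18 resulting terms gives
     2 s Re Tr(O^* (R_rho - R_sigma)) <= 3 s^2 Tr[cost tau] + 3,
   since Tr(O O^* ) <= 3. Optimizing over s yields the bound. *)
Require Import Defs.
From mathcomp Require Import all_boot all_order all_algebra.
From mathcomp Require Import reals complex.
From mathcomp Require Import ring lra.
Set Implicit Arguments.
Unset Strict Implicit.
Unset Printing Implicit Defensive.
Import Order.TTheory GRing.Theory Num.Theory.
Local Open Scope ring_scope.
Local Open Scope sesquilinear_scope.

(** * Adjoints, positive semidefinite matrices and the polar decomposition *)

Section Adjoint.
Variable C : numClosedFieldType.

Lemma adjmxM m n p (A : 'M[C]_(m, n)) (B : 'M_(n, p)) :
  (A *m B)^t* = B^t* *m A^t*.
Proof. by rewrite trmx_mul map_mxM. Qed.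

Lemma adjmxB m n (A B : 'M[C]_(m, n)) : (A - B)^t* = A^t* - B^t*.
Proof. by rewrite linearB map_mxB. Qed.

Lemma adjmxZ m n c (A : 'M[C]_(m, n)) : (c *: A)^t* = c^* *: A^t*.
Proof. by rewrite linearZ map_mxZ. Qed.

Lemma adjmx1 n : (1%:M : 'M[C]_n)^t* = 1%:M.
Proof. by rewrite trmx1 map_mx1. Qed.

Lemma adjmx_tens m n p q (A : 'M[C]_(m, n)) (B : 'M_(p, q)) :
  (A *t B)^t* = A^t* *t B^t*.
Proof. by rewrite trmx_tens map_mxT. Qed.

Lemma mxtrace_adj n (A : 'M[C]_n) : \tr (A^t*) = (\tr A)^*.
Proof. by rewrite rmorph_sum; apply: eq_bigr => i _; rewrite !mxE. Qed.

Lemma mxtrace_mulmx_adj m n (A : 'M[C]_(m, n)) :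
  \tr (A *m A^t*) = \sum_i \sum_j `|A i j| ^+ 2.
Proof.
apply: eq_bigr => i _; rewrite mxE; apply: eq_bigr => j _.
by rewrite !mxE normCK.
Qed.

Lemma mxtrace_mulmx_adj_ge0 m n (A : 'M[C]_(m, n)) : 0 <= \tr (A *m A^t*).
Proof.
rewrite mxtrace_mulmx_adj.
by apply: sumr_ge0 => i _; apply: sumr_ge0 => j _; rewrite exprn_ge0.
Qed.

Lemma psdmx_adj n (A : 'M[C]_n) : psdmx A -> A^t* = A.
Proof. by case; rewrite qualifE /= expr0 scale1r => /eqP. Qed.

Lemma psdmx_gram m n (S : 'M[C]_(m, n)) : psdmx (S *m S^t*).
Proof.
split; first by rewrite qualifE /= expr0 scale1r adjmxM trmxCK.
move=> v; rewrite -trace_mx11.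
have -> : v^t* *m (S *m S^t*) *m v = (v^t* *m S) *m (v^t* *m S)^t*.
  by rewrite adjmxM trmxCK !mulmxA.
exact: mxtrace_mulmx_adj_ge0.
Qed.

Lemma psdmx_adj_mul m n (A : 'M[C]_(m, n)) : psdmx (A^t* *m A).
Proof. by rewrite -{2}[A]trmxCK; apply: psdmx_gram. Qed.

Lemma psdmx_gramP n (A : 'M[C]_n) : psdmx A -> {S : 'M_n | A = S *m S^t*}.
Proof.
move=> Apsd; exists (sqrtmx A).
by rewrite (psdmx_adj (sqrtmx_psd Apsd)) sqrtmxK.
Qed.

(** With [A = S *m S^t*], cyclicity turns the trace into the squared Frobenius norm of
    [M^t* *m S]. *)
Lemma psdmx_trace_ge0 m n (A : 'M[C]_n) (M : 'M_(n, m)) :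
  psdmx A -> 0 <= \tr (A *m (M *m M^t*)).
Proof.
move=> /psdmx_gramP[S ->].
have -> : \tr (S *m S^t* *m (M *m M^t*))
    = \tr ((M^t* *m S) *m (M^t* *m S)^t*).
  by rewrite adjmxM trmxCK [in LHS]mulmxA [in LHS]mxtrace_mulC !mulmxA.
exact: mxtrace_mulmx_adj_ge0.
Qed.

Lemma psdmx_tens m n (A : 'M[C]_m) (B : 'M_n) :
  psdmx A -> psdmx B -> psdmx (A *t B).
Proof.
move=> /psdmx_gramP[S ->] /psdmx_gramP[T ->].
by rewrite -tensmx_mul -adjmx_tens; apply: psdmx_gram.
Qed.

Lemma psdmx_sum (I : finType) n (F : I -> 'M[C]_n) :
  (forall i, psdmx (F i)) -> psdmx (\sum_i F i).
Proof.
move=> Fpsd; split.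
  rewrite qualifE /= expr0 scale1r; apply/eqP/matrixP => i j.
  rewrite !mxE !summxE rmorph_sum; apply: eq_bigr => k _ /=.
  by rewrite -[in LHS](psdmx_adj (Fpsd k)) !mxE.
move=> v; rewrite mulmx_sumr mulmx_suml summxE.
by apply: sumr_ge0 => i _; case: (Fpsd i).
Qed.

Lemma psdmxZ n c (A : 'M[C]_n) : 0 <= c -> psdmx A -> psdmx (c *: A).
Proof.
move=> c0 Apsd; split.
  rewrite qualifE /= expr0 scale1r adjmxZ (psdmx_adj Apsd).
  by rewrite geC0_conj.
move=> v; rewrite -scalemxAr -scalemxAl mxE mulr_ge0 //.
by case: Apsd.
Qed.

(** Expand the nonnegative trace of [tau] against [M *m M^t*] for [M = s *: D - o^* *: B]; the two
    cross terms are conjugate to each other. Keeping [s] free allows many instances to be summed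
    before [s] is chosen. *)
Lemma psdmx_cauchy_schwarz n (tau D B : 'M[C]_n) (s o : C) :
  psdmx tau -> D^t* = D -> B^t* = B -> s^* = s ->
  s * (o * \tr (tau *m (D *m B)) + (o * \tr (tau *m (D *m B)))^*)
    <= s ^+ 2 * \tr (tau *m (D *m D)) + `|o| ^+ 2 * \tr (tau *m (B *m B)).
Proof.
move=> taupsd Dh Bh sr.
have conjDB : (\tr (tau *m (D *m B)))^* = \tr (tau *m (B *m D)).
  by rewrite -mxtrace_adj !adjmxM Dh Bh (psdmx_adj taupsd) mxtrace_mulC.
rewrite -subr_ge0; have := psdmx_trace_ge0 (s *: D - o^* *: B) taupsd.
rewrite adjmxB !adjmxZ Dh Bh conjCK sr normCK rmorphM /= conjDB.
rewrite mulmxBl !mulmxBr -!scalemxAl -!scalemxAr !raddfB /= !linearZ /=.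
congr (0 <= _); ring.
Qed.

Lemma sqrtmx_gram_trace_ge0 m n (A : 'M[C]_(m, n)) :
  0 <= \tr (sqrtmx (A^t* *m A)).
Proof.
have := psdmx_trace_ge0 1%:M (sqrtmx_psd (psdmx_adj_mul A)).
by rewrite mul1mx adjmx1 mulmx1.
Qed.

(* The polar decomposition, with a partial isometry in place of the unitary
   factor: its columns are the normalized images under A of the eigenvectors of
   A^* A, those of norm 0 staying 0 because 0^-1 = 0. *)
Lemma polar_partial_isometry n (A : 'M[C]_n) : exists O : 'M[C]_n,
  O *m O^t* *m O = O /\ \tr (sqrtmx (A^t* *m A)) = \tr (O^t* *m A).
Proof.
have Apsd := psdmx_adj_mul A.
have d_ge0 j := psd_spectral_diag_ge0 j Apsd.
have /hermitian_normalmx/orthomx_spectralP := Apsd.1.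
rewrite /sqrtmx; set P := spectralmx _ in d_ge0 *; set d := spectral_diag _ in d_ge0 *.
have Pu : P \is unitarymx by exact: spectral_unitarymx.
have PP : P *m P^t* = 1%:M by apply/unitarymxP.
rewrite invmx_unitary // => AE.
set s := map_mx sqrtC d.
pose t : 'rV[C]_n := map_mx GRing.inv s.
have s_ge0 j : 0 <= s 0 j by rewrite mxE sqrtC_ge0.
have tadj : (diag_mx t)^t* = diag_mx t.
  apply/matrixP => i j; rewrite !mxE eq_sym.
  case: eqVneq => [->|_]; last by rewrite !mulr0n rmorph0.
  rewrite !mulr1n fmorphV /=; congr _^-1; apply: geC0_conj.
  by rewrite sqrtC_ge0.
pose U := A *m P^t* *m diag_mx t.
have WW : (A *m P^t*)^t* *m (A *m P^t*) = diag_mx d.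
  rewrite adjmxM trmxCK -!mulmxA [A^t* *m _]mulmxA AE !mulmxA PP mul1mx.
  by rewrite -mulmxA PP mulmx1.
(* The entries are [s^-1 * s^2 = s], also at [s = 0]. The trace of this diagonal matrix is the trace
   norm. *)
have UW : U^t* *m (A *m P^t*) = diag_mx s.
  rewrite adjmxM tadj -mulmxA WW mulmx_diag; congr diag_mx.
  apply/rowP => j; rewrite !mxE -[in X in _ * X](sqrtCK (d 0 j)).
  by have [->|nz] := eqVneq (sqrtC (d 0 j)) 0; rewrite ?expr0n ?mulr0 // mulKf.
exists (U *m P); split; last first.
  by rewrite mxtrace_mulC mulmxA PP mul1mx adjmxM -mulmxA mxtrace_mulC
    -mulmxA UW.
(* [U^t* *m U] is the projection onto the nonzero singular values, so the isometry identity reduces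
   to [t * s * t = t] entrywise. *)
have -> : U *m P *m (U *m P)^t* *m (U *m P) = U *m (U^t* *m U) *m P.
  by rewrite adjmxM -!mulmxA [P *m (P^t* *m _)]mulmxA PP mul1mx.
have -> : U^t* *m U = diag_mx s *m diag_mx t by rewrite -UW -mulmxA.
rewrite /U -[A *m P^t* *m _ *m _]mulmxA; congr (_ *m _ *m _).
rewrite !mulmx_diag; congr diag_mx; apply/rowP => j; rewrite !mxE.
have [->|nz] := eqVneq (sqrtC (d 0 j)) 0; first by rewrite invr0 mul0r.
by rewrite mulfV // mulr1.
Qed.

(** * Norm bounds for partial isometries *)

Section PartialIsometry.
Variables (m n : nat) (O : 'M[C]_(m, n)).
Hypothesis Oiso : O *m O^t* *m O = O.

Lemma partial_isometry_adj : O^t* *m O *m O^t* = O^t*.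
Proof. by rewrite -[RHS](congr1 (fun M : 'M_(m, n) => M^t* ) Oiso) !adjmxM trmxCK mulmxA. Qed.

(** Pythagoras: [O^t* *m O] is an orthogonal projection, and the difference of the two sides is the
    squared norm of [Y - O^t* *m O *m Y]. *)
Lemma partial_isometry_norm_le p (Y : 'M[C]_(n, p)) :
  \tr ((O *m Y) *m (O *m Y)^t*) <= \tr (Y *m Y^t*).
Proof.
rewrite -subr_ge0; have := mxtrace_mulmx_adj_ge0 (Y - O^t* *m O *m Y).
congr (0 <= _).
rewrite !adjmxB !adjmxM trmxCK mulmxBl !mulmxBr !raddfB /=.
rewrite [\tr (Y *m (_ *m _))]mxtrace_mulC [\tr (O *m Y *m _)]mxtrace_mulC.
rewrite [\tr (O^t* *m O *m Y *m _)]mxtrace_mulC.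
rewrite [\tr (O^t* *m O *m Y *m (_ *m _))]mxtrace_mulC.
have -> : Y^t* *m (O^t* *m O) *m (O^t* *m O *m Y)
    = Y^t* *m (O^t* *m O *m O^t* ) *m O *m Y by rewrite !mulmxA.
by rewrite partial_isometry_adj !mulmxA; ring.
Qed.

(** Expand the squared norm of [x - O *m y], whose cross terms form the left side, and bound the
    norm of [O *m y] by that of [y]. *)
Lemma partial_isometry_form_le (x : 'cV[C]_m) (y : 'cV[C]_n) :
  \tr (O^t* *m (x *m y^t*)) + (\tr (O^t* *m (x *m y^t*)))^*
    <= \tr (x *m x^t*) + \tr (y *m y^t*).
Proof.
apply: le_trans (lerD (lexx _) (partial_isometry_norm_le y)).
rewrite -subr_ge0; have := mxtrace_mulmx_adj_ge0 (x - O *m y).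
congr (0 <= _).
rewrite adjmxB adjmxM mulmxBl !mulmxBr !raddfB /= -mxtrace_adj.
rewrite !adjmxM !trmxCK.
have -> : \tr (x *m (y^t* *m O^t*)) = \tr (O^t* *m (x *m y^t*)).
  by rewrite mulmxA mxtrace_mulC.
have -> : \tr (O *m y *m x^t*) = \tr (y *m x^t* *m O).
  by rewrite -mulmxA mxtrace_mulC.
ring.
Qed.

(** [1 - O *m O^t*] is an orthogonal projection, hence its own Gram matrix, and its trace is
    nonnegative. *)
Lemma partial_isometry_frobenius : \tr (O *m O^t*) <= m%:R.
Proof.
rewrite -subr_ge0 -[m%:R](mxtrace1 C m) -raddfB /=.
suff -> : 1%:M - O *m O^t* = (1%:M - O *m O^t*) *m (1%:M - O *m O^t*)^t*.
  exact: mxtrace_mulmx_adj_ge0.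
rewrite adjmxB adjmx1 adjmxM trmxCK mulmxBr mulmx1 mulmxBl mul1mx.
by rewrite mulmxA Oiso subrr subr0.
Qed.

End PartialIsometry.

End Adjoint.


(** * Tensor product identities and two algebraic identities *)

Lemma big_mxtens_index (V : nmodType) m n (F : 'I_(m * n) -> V) :
  \sum_k F k = \sum_i \sum_j F (mxtens_index (i, j)).
Proof.
rewrite pair_bigA /= (reindex (@mxtens_index m n)); last first.
  by apply: onW_bij; exists (@mxtens_unindex m n);
    [exact: mxtens_indexK | exact: mxtens_unindexK].
by apply: eq_bigr => -[].
Qed.

Lemma mxtrace_tens (K : comPzRingType) m n (A : 'M[K]_m) (B : 'M_n) :
  \tr (A *t B) = \tr A * \tr B.
Proof.
rewrite /mxtrace big_mxtens_index mulr_suml; apply: eq_bigr => i _.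
by rewrite mulr_sumr; apply: eq_bigr => j _; rewrite tensmxE.
Qed.

Lemma tens1mx_mul m n (K : comPzRingType) (A B : 'M[K]_n) :
  (1%:M : 'M_m) *t (A *m B) = ((1%:M : 'M_m) *t A) *m ((1%:M : 'M_m) *t B).
Proof. by rewrite tensmx_mul mul1mx. Qed.

Lemma tensmx1_mul m n (K : comPzRingType) (A B : 'M[K]_n) :
  (A *m B) *t (1%:M : 'M_m) = (A *t (1%:M : 'M_m)) *m (B *t (1%:M : 'M_m)).
Proof. by rewrite tensmx_mul mul1mx. Qed.

Lemma tensmx11 (K : comPzRingType) m n : (1%:M : 'M[K]_m) *t (1%:M : 'M_n) = 1%:M.
Proof.
apply/matrixP => i j; case: (mxtens_indexP i) => i1 i2.
case: (mxtens_indexP j) => j1 j2; rewrite tensmxE !mxE -natrM mulnb.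
by rewrite (can_eq (@mxtens_indexK _ _)) xpair_eqE.
Qed.

(** A term depending on one index alone is counted [n] times in the double sum. For [n = 3] this is
    the factor 3 in front of the cost. *)
Lemma sum_separate (K : pzSemiRingType) n (F G : 'I_n -> K) (H : 'I_n -> 'I_n -> K) :
  \sum_a \sum_b (F a + G b + H a b)
  = n%:R * (\sum_a F a + \sum_b G b) + \sum_a \sum_b H a b.
Proof.
under eq_bigr do rewrite !big_split /= sumr_const card_ord -mulr_natl.
by rewrite !big_split /= sumr_const card_ord mulrDr mulr_sumr mulr_natl.
Qed.

(** Telescoping through the mixed product [A2 *m B1 = B1 *m A2], which cancels. *)
Lemma mulmx_commuting_diff (K : pzRingType) n (A1 A2 B1 B2 : 'M[K]_n) :
  B1 *m A2 = A2 *m B1 ->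
  A1 *m B1 - B2 *m A2 = (A1 - A2) *m B1 + (B1 - B2) *m A2.
Proof. by move=> cBA; rewrite !mulmxBl cBA addrA subrK. Qed.

Section TwoQubits.
Variable R : realType.
Local Notation C := R[i].

(** * Partial traces, couplings and separable states *)

Lemma marginal1_trace m n (tau : 'M[C]_(m * n)) (X : 'M_m) :
  \tr (tau *m (X *t 1%:M)) = \tr (marginal1 tau *m X).
Proof.
rewrite /mxtrace big_mxtens_index; apply: eq_bigr => i _.
under eq_bigr do rewrite mxE big_mxtens_index.
rewrite exchange_big mxE; apply: eq_bigr => k _ /=.
rewrite mxE mulr_suml; apply: eq_bigr => j _.
rewrite (bigD1 j) //= big1 => [|l /negPf lj]; rewrite tensmxE mxE.
  by rewrite eqxx mulr1 addr0.
by rewrite lj !mulr0.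
Qed.

Lemma marginal2_trace m n (tau : 'M[C]_(m * n)) (X : 'M_n) :
  \tr (tau *m (1%:M *t X)) = \tr (marginal2 tau *m X).
Proof.
rewrite /mxtrace big_mxtens_index exchange_big; apply: eq_bigr => i _ /=.
under eq_bigr do rewrite mxE big_mxtens_index exchange_big.
rewrite exchange_big mxE; apply: eq_bigr => k _ /=.
rewrite mxE mulr_suml; apply: eq_bigr => j _.
rewrite (bigD1 j) //= big1 => [|l /negPf lj]; rewrite tensmxE mxE.
  by rewrite eqxx mul1r addr0.
by rewrite lj mul0r mulr0.
Qed.

Lemma marginal1_tens m n (A : 'M[C]_m) (B : 'M_n) :
  marginal1 (A *t B) = \tr B *: A.
Proof.
apply/matrixP => i j; rewrite !mxE mulr_suml; apply: eq_bigr => k _.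
by rewrite tensmxE mulrC.
Qed.

Lemma marginal2_tens m n (A : 'M[C]_m) (B : 'M_n) :
  marginal2 (A *t B) = \tr A *: B.
Proof.
apply/matrixP => i j; rewrite !mxE mulr_suml; apply: eq_bigr => k _.
by rewrite tensmxE.
Qed.

Lemma density_tens m n (A : 'M[C]_m) (B : 'M_n) :
  density A -> density B -> density (A *t B).
Proof.
move=> [Apsd trA] [Bpsd trB]; split; first exact: psdmx_tens.
by rewrite mxtrace_tens trA trB mulr1.
Qed.

Lemma couplings_tens m n (A : 'M[C]_m) (B : 'M_n) :
  density A -> density B -> couplings A B (A *t B).
Proof.
move=> dA dB; split; first exact: density_tens.
  by rewrite marginal1_tens dB.2 scale1r.
by rewrite marginal2_tens dA.2 scale1r.
Qed.

Lemma density_separable m n (sigma : 'M[C]_(m * n)) :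
  separable sigma -> density sigma.
Proof.
move=> [k [p [a [b [p0 p1 da db ->]]]]]; split.
  apply: psdmx_sum => i; apply: psdmxZ; first by rewrite lecR.
  exact: psdmx_tens (da i).1 (db i).1.
rewrite raddf_sum /=.
under eq_bigr do rewrite linearZ /= (density_tens (da _) (db _)).2 mulr1.
by rewrite -(raddf_sum (real_complex R)) p1.
Qed.

(** The maximally mixed state; its tensor square serves as a witness that separable states exist. *)
Lemma density_scalar n : density ((n.+1%:R^-1)%:M : 'M[C]_n.+1).
Proof.
split; last by rewrite mxtrace_scalar -[LHS]mulr_natr mulVf ?pnatr_eq0.
rewrite -scalemx1; apply: psdmxZ; first by rewrite invr_ge0 ler0n.
rewrite -[1%:M]mulmx1 -{2}(adjmx1 C n.+1); exact: psdmx_gram.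
Qed.

Lemma separable_tens m n (A : 'M[C]_m) (B : 'M_n) :
  density A -> density B -> separable (A *t B).
Proof.
move=> dA dB; exists 1%N, (fun=> 1), (fun=> A), (fun=> B).
by split=> //; rewrite big_ord1 // scale1r.
Qed.

(** * Pauli matrices and Bloch vectors *)

Lemma mx22_mul (a b c d a' b' c' d' : C) :
  mx22 a b c d *m mx22 a' b' c' d'
  = mx22 (a * a' + b * c') (a * b' + b * d') (c * a' + d * c') (c * b' + d * d').
Proof.
apply/matrixP => i j; rewrite !mxE !big_ord_recl big_ord0 !mxE /= addr0.
by case: (i == 0); case: (j == 0).
Qed.

Lemma mx22_adj (a b c d : C) : (mx22 a b c d)^t* = mx22 a^* c^* b^* d^*.
Proof.
by apply/matrixP => i j; rewrite !mxE; case: (i == 0); case: (j == 0).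
Qed.

Lemma mx22_scalar (a : C) : mx22 a 0 0 a = a%:M.
Proof.
by apply/matrixP => -[[|[|//]] hi] [[|[|//]] hj]; rewrite !mxE.
Qed.

Lemma pauli_adj k : (pauli R k)^t* = pauli R k.
Proof.
case: k => -[|[|[|//]]] hk; rewrite /pauli /= mx22_adj; congr mx22;
  by apply/eqP; rewrite eq_complex /= ?oppr0 ?opprK !eqxx.
Qed.

(** One identity containing both [sigma_a^2 = 1] and the anticommutation of distinct Pauli matrices.
    It is checked on the explicit 2 by 2 matrix, for complex [y] and without conjugation. *)
Lemma pauli_vector_sqr (y : 'I_3 -> C) :
  (\sum_a y a *: pauli R a) *m (\sum_a y a *: pauli R a)
  = (\sum_a y a ^+ 2)%:M.
Proof.
have -> : \sum_a y a *: pauli R a = mx22 (y (lift ord0 (lift ord0 ord0)))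
    (y ord0 - 'i%C * y (lift ord0 ord0)) (y ord0 + 'i%C * y (lift ord0 ord0))
    (- y (lift ord0 (lift ord0 ord0))).
  rewrite !big_ord_recl big_ord0 /pauli /=.
  by apply/matrixP => i j; rewrite !mxE; case: (i == 0); case: (j == 0) => /=; ring.
rewrite mx22_mul -mx22_scalar !big_ord_recl big_ord0.
have ii : 'i%C * 'i%C = -1 :> C by rewrite -expr2 sqr_i.
congr mx22; ring: ii.
Qed.

Lemma invsqrt2_sqr : (Num.sqrt 2)^-1%:C%C * (Num.sqrt 2)^-1%:C%C = 2^-1 :> C.
Proof.
rewrite -rmorphM /= -expr2 exprVn sqr_sqrtr ?ler0n //.
by rewrite fmorphV rmorph_nat.
Qed.

Lemma pauli_basis_adj k : (pauli_basis R k)^t* = pauli_basis R k.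
Proof.
rewrite /pauli_basis adjmxZ pauli_adj; congr (_ *: _).
by rewrite conj_Creal // complex_real.
Qed.

Lemma pauli_basis_sqr k : pauli_basis R k *m pauli_basis R k = (2^-1)%:M.
Proof.
have := pauli_vector_sqr (fun a => (a == k)%:R).
have -> : \sum_a (a == k)%:R *: pauli R a = pauli R k.
  rewrite (bigD1 k) //= eqxx scale1r big1 ?addr0 // => i /negPf ->.
  by rewrite scale0r.
rewrite (bigD1 k) //= eqxx expr1n big1 ?addr0 => [|i /negPf ->]; last by rewrite expr0n.
move=> sq; rewrite /pauli_basis -scalemxAl -scalemxAr scalerA sq invsqrt2_sqr.
by rewrite scalemx1.
Qed.

(** The usual Bloch vector divided by the square root of 2, so that pure states have squared norm
    1/2. *)
Definition bloch (alpha : 'M[C]_2) : 'cV[C]_3 :=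
  \col_a \tr (alpha *m pauli_basis R a).

Lemma bloch_real alpha : density alpha -> forall a, (bloch alpha a 0)^* = bloch alpha a 0.
Proof.
move=> [apsd _] a; rewrite !mxE -mxtrace_adj adjmxM pauli_basis_adj.
by rewrite (psdmx_adj apsd) mxtrace_mulC.
Qed.

(** Let [N] be the combination of the [pauli_basis R a] with the Bloch coordinates as coefficients,
    and [q] the squared norm. Then [N] has expectation [q] and its square is the scalar [q / 2], so
    nonnegativity of the expectation of a shifted square of [N] bounds [q]. *)
Lemma bloch_norm_le alpha :
  density alpha -> \tr (bloch alpha *m (bloch alpha)^t*) <= 2^-1.
Proof.
move=> da; have [apsd atr] := da.
set y := bloch alpha.
have yr a : (y a 0)^* = y a 0 by exact: bloch_real.
have -> : \tr (y *m y^t*) = \sum_a y a 0 ^+ 2.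
  rewrite mxtrace_mulmx_adj; apply: eq_bigr => a _.
  by rewrite big_ord1 normCK yr expr2.
set q := \sum_a _.
pose N := \sum_a y a 0 *: pauli_basis R a.
have NE : N = (Num.sqrt 2)^-1%:C%C *: \sum_a y a 0 *: pauli R a.
  by rewrite scaler_sumr; apply: eq_bigr => a _; rewrite scalerA mulrC -scalerA.
have NN : N *m N = (2^-1 * q)%:M.
  rewrite NE -scalemxAl -scalemxAr scalerA invsqrt2_sqr pauli_vector_sqr.
  by rewrite scale_scalar_mx.
have Nadj : N^t* = N.
  rewrite /N linear_sum map_mx_sum; apply: eq_bigr => a _ /=.
  by rewrite adjmxZ pauli_basis_adj yr.
have trN : \tr (alpha *m N) = q.
  rewrite mulmx_sumr raddf_sum; apply: eq_bigr => a _ /=.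
  by rewrite -scalemxAr linearZ expr2; congr (_ * _); rewrite /y mxE.
(* The shift 1/2 gives [q / 2 - q + 1 / 4 >= 0], that is [q <= 1 / 2]; no other shift gives a
   smaller bound. *)
have := psdmx_trace_ge0 (N - (2^-1)%:M) apsd.
have -> : (N - (2^-1)%:M)^t* = N - (2^-1)%:M.
  rewrite adjmxB Nadj tr_scalar_mx map_scalar_mx; congr (_ - _%:M).
  by rewrite /= fmorphV rmorph_nat.
rewrite mulmxBl !mulmxBr NN mul_scalar_mx mul_mx_scalar -scalar_mxM.
rewrite !raddfB /= -scalemxAr !mul_mx_scalar !linearZ /= trN atr.
move=> h; rewrite -subr_ge0 -(pmulr_rge0 _ (_ : 0 < 2^-1)) ?invr_gt0 ?ltr0n //.
move: h; congr (0 <= _).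
by rewrite -![_ *: _]/(_ * _); field.
Qed.

(** * Correlation matrices of product and separable states *)

Lemma corr_mxE (rho : 'M[C]_(2 * 2)) a b :
  corr_mx rho a b = \tr (rho *m (pauli_basis R a *t pauli_basis R b)).
Proof.
(* The factor 1/2 of [corr_mx] is the product of the two normalizations of [pauli_basis]. *)
rewrite mxE /pauli_basis -invsqrt2_sqr.
suff -> : (Num.sqrt 2)^-1%:C%C *: pauli R a *t ((Num.sqrt 2)^-1%:C%C *: pauli R b)
  = ((Num.sqrt 2)^-1%:C%C * (Num.sqrt 2)^-1%:C%C) *: (pauli R a *t pauli R b).
  by rewrite -scalemxAr linearZ.
by apply/matrixP => i j; rewrite !mxE mulrACA.
Qed.

(** Expectations factor in a product state, so the matrix has rank at most one. As the Bloch vector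
    of [beta] is real, its adjoint is its transpose. *)
Lemma corr_mx_tens (alpha beta : 'M[C]_2) :
  density beta -> corr_mx (alpha *t beta) = bloch alpha *m (bloch beta)^t*.
Proof.
move=> db; apply/matrixP => a b; rewrite corr_mxE tensmx_mul mxtrace_tens.
rewrite mxE big_ord1 [X in _ = _ * X]mxE [X in _ = _ * Num.conj X]mxE bloch_real //.
by rewrite !mxE.
Qed.

(** The left side is twice a real part and is linear in convex weights. On a product state it is at
    most the sum of two squared Bloch norms, each at most 1/2. *)
Lemma corr_mx_separable_le (O : 'M[C]_3) (sigma : 'M[C]_(2 * 2)) :
  O *m O^t* *m O = O -> separable (m := 2) (n := 2) sigma ->
  \tr (O^t* *m corr_mx sigma) + (\tr (O^t* *m corr_mx sigma))^* <= 1.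
Proof.
move=> Oiso [k [p [a [b [p0 p1 da db ->]]]]].
pose X i := \tr (O^t* *m corr_mx (a i *t b i)).
have -> : \tr (O^t* *m corr_mx (\sum_i (p i)%:C%C *: (a i *t b i)))
    = \sum_i (p i)%:C%C * X i.
  have -> : corr_mx (\sum_i (p i)%:C%C *: (a i *t b i))
      = \sum_i (p i)%:C%C *: corr_mx (a i *t b i).
    apply/matrixP => u v; rewrite corr_mxE summxE mulmx_suml raddf_sum.
    apply: eq_bigr => i _ /=.
    by rewrite -scalemxAl linearZ /= [in RHS]mxE corr_mxE.
  rewrite mulmx_sumr raddf_sum; apply: eq_bigr => i _ /=.
  by rewrite -scalemxAr linearZ.
rewrite rmorph_sum -big_split /=.
(* The bound 1 is split along the weights, so that product states are compared term by term. *)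
have -> : 1 = \sum_i (p i)%:C%C :> C by rewrite -(raddf_sum (real_complex R)) p1.
apply: ler_sum => i _.
rewrite rmorphM /= [((p i)%:C%C)^*]conj_Creal ?complex_real // -mulrDr.
rewrite -[X in _ <= X]mulr1 ler_wpM2l ?lecR //.
rewrite /X corr_mx_tens //; apply: le_trans (partial_isometry_form_le Oiso _ _) _.
apply: le_trans (lerD (bloch_norm_le (da i)) (bloch_norm_le (db i))) _.
by rewrite le_eqVlt; apply/orP; left; apply/eqP; field.
Qed.

(** * Local operators on two copies and the cost *)

Local Notation qubits := (2 * 2)%N.

Lemma local_ops_adj x : (local_ops R x)^t* = local_ops R x.
Proof. by case: x => k; rewrite /local_ops adjmx_tens adjmx1 pauli_basis_adj. Qed.

Lemma local_ops_sqr x : local_ops R x *m local_ops R x = 2^-1 *: 1%:M.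
Proof.
case: x => k; rewrite /local_ops tensmx_mul mul1mx pauli_basis_sqr
  -scalemx1 -tensmx11; apply/matrixP => i j; rewrite !mxE; ring.
Qed.

Lemma local_ops_mul a b :
  local_ops R (inl a) *m local_ops R (inr b) = pauli_basis R a *t pauli_basis R b.
Proof. by rewrite /local_ops tensmx_mul mul1mx mulmx1. Qed.

Lemma local_opsC a b : local_ops R (inl a) *m local_ops R (inr b)
  = local_ops R (inr b) *m local_ops R (inl a).
Proof. by rewrite /local_ops !tensmx_mul !mul1mx !mulmx1. Qed.

Definition copy1 (X : 'M[C]_qubits) : 'M[C]_(qubits * qubits) := X *t 1%:M.
Definition copy2 (X : 'M[C]_qubits) : 'M[C]_(qubits * qubits) := 1%:M *t X.

Definition op_diff x := copy1 (local_ops R x) - copy2 (local_ops R x).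

Lemma copy1_adj X : (copy1 X)^t* = copy1 (X^t*).
Proof. by rewrite /copy1 adjmx_tens adjmx1. Qed.

Lemma copy2_adj X : (copy2 X)^t* = copy2 (X^t*).
Proof. by rewrite /copy2 adjmx_tens adjmx1. Qed.

Lemma op_diff_adj x : (op_diff x)^t* = op_diff x.
Proof. by rewrite adjmxB copy1_adj copy2_adj local_ops_adj. Qed.

Lemma copy12C X Y : copy1 X *m copy2 Y = copy2 Y *m copy1 X.
Proof. by rewrite /copy1 /copy2 !tensmx_mul !mul1mx !mulmx1. Qed.

Lemma copy1_sqr x : copy1 (local_ops R x) *m copy1 (local_ops R x) = 2^-1 *: 1%:M.
Proof.
rewrite -tensmx1_mul local_ops_sqr -[in RHS]tensmx11.
by apply/matrixP => i j; rewrite !mxE mulrA.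
Qed.

Lemma copy2_sqr x : copy2 (local_ops R x) *m copy2 (local_ops R x) = 2^-1 *: 1%:M.
Proof.
rewrite -tens1mx_mul local_ops_sqr -[in RHS]tensmx11.
by apply/matrixP => i j; rewrite !mxE mulrCA.
Qed.

(** On the second copy the two local factors are first interchanged; the mixed product left to
    cancel then has its factors on different copies, where they commute. *)
Lemma correlation_diff a b (X := local_ops R (inl a) *m local_ops R (inr b)) :
  copy1 X - copy2 X = op_diff (inl a) *m copy1 (local_ops R (inr b))
    + op_diff (inr b) *m copy2 (local_ops R (inl a)).
Proof.
set A := local_ops R (inl a) in X *; set B := local_ops R (inr b) in X *.
have -> : copy1 X = copy1 A *m copy1 B by exact: tensmx1_mul.
have -> : copy2 X = copy2 B *m copy2 A.
  by rewrite /X /A /B local_opsC; exact: tens1mx_mul.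
exact/mulmx_commuting_diff/copy12C.
Qed.

Lemma cost_trace tau :
  \tr (cost R *m tau) = \sum_x \tr (tau *m (op_diff x *m op_diff x)).
Proof.
rewrite mxtrace_mulC mulmx_sumr raddf_sum; apply: eq_bigr => x _ /=.
by rewrite expr2.
Qed.

(** The marginals of [tau] make both correlation entries expectations in the single state [tau], so
    their difference is the expectation of the operator split above. *)
Lemma corr_mx_diff (rho sigma : 'M[C]_qubits) tau a b :
  couplings rho sigma tau ->
  (corr_mx rho - corr_mx sigma) a b
  = \tr (tau *m (op_diff (inl a) *m copy1 (local_ops R (inr b))))
    + \tr (tau *m (op_diff (inr b) *m copy2 (local_ops R (inl a)))).
Proof.
move=> [_ m1 m2]; rewrite -raddfD -mulmxDr -correlation_diff mulmxBr raddfB /=.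
rewrite marginal1_trace marginal2_trace m1 m2 local_ops_mul -!corr_mxE.
by rewrite !mxE.
Qed.

(** * From correlation differences to the transport cost *)

Lemma corr_mx_coupling_le (O : 'M[C]_3) (rho sigma : 'M[C]_qubits) tau (s : C)
    (Z := \tr (O^t* *m (corr_mx rho - corr_mx sigma))) :
  O *m O^t* *m O = O -> couplings rho sigma tau -> s^* = s ->
  s * (Z + Z^*) <= 3 * s ^+ 2 * \tr (cost R *m tau) + 3.
Proof.
move=> Oiso ctau sr; have [[taupsd tautr] _ _] := ctau.
pose e1 a b := \tr (tau *m (op_diff (inl a) *m copy1 (local_ops R (inr b)))).
pose e2 a b := \tr (tau *m (op_diff (inr b) *m copy2 (local_ops R (inl a)))).
pose d x := \tr (tau *m (op_diff x *m op_diff x)).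
have add_halves (K : numFieldType) (p q x : K) :
    p + x * 2^-1 + (q + x * 2^-1) = p + q + x by field.
have trhalf : \tr (tau *m (2^-1 *: 1%:M)) = 2^-1.
  by rewrite -scalemxAr mulmx1 linearZ /= tautr mulr1.
have ZE : Z = \sum_a \sum_b ((O a b)^* * e1 a b + (O a b)^* * e2 a b).
  rewrite exchange_big; apply: eq_bigr => b _; rewrite mxE.
  apply: eq_bigr => a _; rewrite (corr_mx_diff _ _ ctau) mulrDr.
  by rewrite !mxE.
have -> : s * (Z + Z^*) = \sum_a \sum_b
    (s * ((O a b)^* * e1 a b + ((O a b)^* * e1 a b)^*)
     + s * ((O a b)^* * e2 a b + ((O a b)^* * e2 a b)^*)).
  rewrite ZE rmorph_sum -big_split mulr_sumr; apply: eq_bigr => a _ /=.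
  rewrite rmorph_sum -big_split mulr_sumr; apply: eq_bigr => b _ /=.
  by rewrite rmorphD /= [X in s * X]addrACA mulrDr.
apply: (@le_trans _ _ (\sum_a \sum_b
    (s ^+ 2 * d (inl a) + s ^+ 2 * d (inr b) + `|O a b| ^+ 2))).
  apply: ler_sum => a _; apply: ler_sum => b _.
  (* The coefficient is the conjugate entry of [O], and the second operator squares to 1/2. The two
     instances thus contribute half of the squared modulus of [O a b] each. *)
  have h1 := psdmx_cauchy_schwarz (O a b)^* taupsd (op_diff_adj (inl a))
    (etrans (copy1_adj _) (congr1 copy1 (local_ops_adj (inr b)))) sr.
  have h2 := psdmx_cauchy_schwarz (O a b)^* taupsd (op_diff_adj (inr b))
    (etrans (copy2_adj _) (congr1 copy2 (local_ops_adj (inl a)))) sr.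
  apply: le_trans (lerD h1 h2) _.
  by rewrite copy1_sqr copy2_sqr trhalf norm_conjC add_halves.
have sqO : \sum_a \sum_b `|O a b| ^+ 2 <= 3 :> C.
  by rewrite -mxtrace_mulmx_adj; apply: partial_isometry_frobenius.
apply: le_trans (lerD (lexx _) sqO).
have -> : \tr (cost R *m tau) = \sum_a d (inl a) + \sum_b d (inr b).
  by rewrite cost_trace big_sumType.
(* Each of the six squares occurs in three of the nine index pairs. *)
rewrite (sum_separate (fun a => s ^+ 2 * d (inl a)) (fun b => s ^+ 2 * d (inr b))).
by clearbody d; rewrite -!mulr_sumr -mulrDr mulrA.
Qed.

Lemma cost_trace_ge0 tau : psdmx tau -> 0 <= \tr (cost R *m tau).
Proof.
move=> taupsd; rewrite cost_trace; apply: sumr_ge0 => x _.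
by rewrite -{2}(op_diff_adj x) psdmx_trace_ge0.
Qed.

Lemma ge0_Re (z : C) : 0 <= z -> z = (complex.Re z)%:C%C.
Proof. by move=> /ger0_real/RRe_real. Qed.

(** For the polar factor [O], the trace of [O^t* *m corr_mx rho] is the real number [T], and twice
    the real part of the corresponding trace [X] for [sigma] is at most 1. So [2 * T - 1] is at most
    twice the real part of [T - X], and [0 <= s] preserves this. *)
Lemma trace_norm_coupling_le (rho sigma : 'M[C]_qubits) tau (s : R) :
  separable (m := 2) (n := 2) sigma -> couplings rho sigma tau -> 0 <= s ->
  s * (2 * trace_norm (corr_mx rho) - 1)
    <= 3 * s ^+ 2 * complex.Re (\tr (cost R *m tau)) + 3.
Proof.
move=> ssep ctau s0; have [[taupsd _] _ _] := ctau.
have [O [Oiso trO]] := polar_partial_isometry (corr_mx rho).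
have sr : (s%:C%C)^* = s%:C%C by rewrite conj_Creal // complex_real.
have := corr_mx_coupling_le Oiso ctau sr.
have := corr_mx_separable_le Oiso ssep.
set X := \tr _.
rewrite mulmxBr raddfB /= -trO -/X rmorphB /=.
have T0 := sqrtmx_gram_trace_ge0 (corr_mx rho).
rewrite (geC0_conj T0) (ge0_Re T0) -/(trace_norm _).
rewrite (ge0_Re (cost_trace_ge0 taupsd)).
set T := trace_norm _; set D := complex.Re _ => X1 le3.
rewrite -lecR; apply: le_trans (le_trans _ le3) _; last first.
  by rewrite rmorphD !rmorphM /= rmorph_nat expr2.
rewrite rmorphM rmorphB rmorphM /= rmorph_nat rmorph1.
rewrite ler_wpM2l ?lecR //.
rewrite -subr_ge0; move: X1; rewrite -subr_ge0; congr (0 <= _); ring.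
Qed.

Lemma separable_transport_ge (rho sigma : 'M[C]_qubits) tau :
  separable (m := 2) (n := 2) sigma -> couplings rho sigma tau ->
  2^-1 <= trace_norm (corr_mx rho) ->
  (3^-1 * (trace_norm (corr_mx rho) - 2^-1)) ^+ 2
    <= complex.Re (\tr (cost R *m tau)).
Proof.
move=> ssep ctau.
have := fun s => @trace_norm_coupling_le rho sigma tau s ssep ctau.
have [[taupsd _] _ _] := ctau.
have := cost_trace_ge0 taupsd; rewrite {1}(ge0_Re (cost_trace_ge0 taupsd)) lecR.
set T := trace_norm _; set D := complex.Re _ => D0 key.
(* At equality the claim is [0 <= D]; it is treated apart because the choice of [s] below divides by
   [T - 2^-1]. *)
rewrite le_eqVlt => /orP[/eqP <-|Tgt]; first by rewrite subrr mulr0 expr0n.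
have x0 : 0 < T - 2^-1 by rewrite subr_gt0.
(* With [x = T - 2^-1], the value [s = 3 / x] is optimal: [2 * s * x <= 3 * s^2 * D + 3] becomes
   [6 <= 27 * D / x^2 + 3], that is [x^2 / 9 <= D]. *)
have := key (3 / (T - 2^-1)) (divr_ge0 (ler0n _ _) (ltW x0)).
have -> : 2 * T - 1 = 2 * (T - 2^-1) by field.
move: (T - 2^-1) x0 => x x0.
rewrite mulrCA divfK ?gt_eqF // expr_div_n => h.
have : 3 <= 27 * D / x ^+ 2.
  have -> : 27 * D / x ^+ 2 = 3 * (3 ^+ 2 / x ^+ 2) * D.
    by field; rewrite gt_eqF.
  lra.
rewrite ler_pdivlMr ?exprn_gt0 // exprMn => h2.
by rewrite exprVn; lra.
Qed.

End TwoQubits.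

Theorem theorem7 (R : realType) (rho : 'M[R[i]]_(2 * 2)) (hrho : density rho) :
  3^-1 * (trace_norm (corr_mx rho) - 2^-1) <= wasserstein_ent rho.
Proof.
apply: lb_le_inf.
  (* The infimum needs a nonempty set, as it is 0 by convention on the empty one; the maximally
     mixed product state is a member. *)
  have d2 := density_scalar R 1.
  by exists (W1 rho ((2^-1)%:M *t (2^-1)%:M));
    exists ((2^-1)%:M *t (2^-1)%:M) => //; exact: separable_tens.
move=> _ [sigma ssep <-]; rewrite /W1.
(* For trace norm at most 1/2 the bound is nonpositive and the distance, a square root, is
   nonnegative. Otherwise the bound is the root of its square, and squares can be compared under the
   root. *)
have [Tle|/ltW Tge] := leP (trace_norm (corr_mx rho)) 2^-1.
  apply: le_trans (sqrtr_ge0 _).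
  by rewrite mulr_ge0_le0 ?invr_ge0 ?ler0n // subr_le0.
rewrite -[leLHS]ger0_norm; last by rewrite mulr_ge0 ?invr_ge0 ?ler0n // subr_ge0.
rewrite -sqrtr_sqr; apply: ler_wsqrtr; apply: lb_le_inf.
  (* The product coupling makes the inner set nonempty. *)
  exists (complex.Re (\tr (cost R *m (rho *t sigma)))), (rho *t sigma) => //.
  exact: couplings_tens (density_separable ssep).
by move=> _ [tau ctau <-]; exact: (separable_transport_ge ssep ctau Tge).
Qed.
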